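(* Let $K$ be a field and let $G$ be an arbitrary chordal graph with edge ideal $I(G)$. Then there exists a simplicial complex $\Delta$ whose $f$-vector $f(\Delta)$ coincides with the Betti sequence $\beta(I(G))$ of $I(G)$; that is, $f_i(\Delta)=\beta_i(I(G))$ for all $i\ge 0$.
   Context: Graphs are finite, with no loops and no multiple edges. A graph $G$ is chordal if each cycle of $G$ of length $>3$ has a chord. For a graph $G$ on vertex set $V$ with edge set $E(G)$, let $S=K[\{x : x\in V\}]$ be the polynomial ring in $|V|$ variables with each $\deg x=1$; the edge ideal $I(G)\subset S$ is the ideal generated by the monomials $xy$ with $\{x,y\}\in E(G)$. The Betti sequence of a homogeneous ideal $I\subset S$ is $\beta(I)=(\beta_0(I),\dots,\beta_p(I))$, where $\beta_i(I)=\dim_K \mathrm{Tor}_i^S(I,K)$ is the $i$th total Betti number of $I$ and $p=\mathrm{proj\,dim}\, I$. The $f$-vector of a (finite, abstract) simplicial complex $\Delta$ of dimension $d-1$ is $f(\Delta)=(f_0,\dots,f_{d-1})$, where $f_i=f_i(\Delta)$ is the number of faces of $\Delta$ of dimension $i$. *)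

(* Defs.v *)
From Stdlib Require Import ClassicalEpsilon.
From HB Require Import structures.
From mathcomp Require Import all_boot all_order all_algebra.
From mathcomp.multinomials Require Import mpoly.

Set Implicit Arguments.
Unset Strict Implicit.
Unset Printing Implicit Defensive.

Import GRing.Theory.
Local Open Scope ring_scope.

Definition simple_graph (V : finType) (e : rel V) : Prop :=
  ssrbool.symmetric e /\ irreflexive e.

(* A chord joins two vertices of the cycle that are not consecutive on it. *)
Definition has_chord (V : finType) (e : rel V) (c : seq V) : Prop :=
  exists x y : V,
    [/\ x \in c, y \in c, e x y, y != next c x & x != next c y].

Definition chordal (V : finType) (e : rel V) : Prop :=
  forall c : seq V, ucycle e c -> (3 < size c)%N -> has_chord e c.

(* The variable x_v of S = K[{x_v : v in V}], for the fixed numbering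
   [enum_rank] of V. *)
Definition vvar (K : fieldType) (V : finType) (v : V) : {mpoly K[#|V|]} :=
  'X_(enum_rank v).

Definition edge_ideal (K : fieldType) (V : finType) (e : rel V)
    (f : {mpoly K[#|V|]}) : Prop :=
  exists c : V -> V -> {mpoly K[#|V|]},
    f = \sum_u \sum_(v | e u v) c u v * (vvar K u * vvar K v).

(* A sequence of maps  ... -> S^(rk 2) -> S^(rk 1) -> S^(rk 0) -> S  between
   finite free S-modules, S = K[x_1, ..., x_n].  Elements of S^r are row
   vectors, on which matrices act by right multiplication. *)
Record free_seq (K : fieldType) (n : nat) := FreeSeq {
  rk : nat -> nat;
  aug : 'cV[{mpoly K[n]}]_(rk 0);
  dif : forall i : nat, 'M[{mpoly K[n]}]_(rk i.+1, rk i)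
}.

(* Exactness of  ... -> S^(rk 1) -> S^(rk 0) -> I -> 0. *)
Definition free_resolution (K : fieldType) (n : nat)
    (I : {mpoly K[n]} -> Prop) (F : free_seq K n) : Prop :=
  [/\ forall f : {mpoly K[n]},
        I f <-> exists v : 'rV_(rk F 0), v *m aug F = f%:M,
      forall v : 'rV_(rk F 0),
        v *m aug F = 0 <-> exists w : 'rV_(rk F 1), v = w *m dif F 0
    & forall (i : nat) (v : 'rV_(rk F i.+1)),
        v *m dif F i = 0 <-> exists w : 'rV_(rk F i.+2), v = w *m dif F i.+1].

(* The differential of F (x)_S K, where K = S / (x_1, ..., x_n): each entry is
   replaced by its constant term. *)
Definition dif_K (K : fieldType) (n : nat) (F : free_seq K n) (i : nat) :
    'M[K]_(rk F i.+1, rk F i) :=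
  map_mx (fun p : {mpoly K[n]} => p@_0%MM) (dif F i).

(* dim_K H_i(F (x)_S K); the augmentation is not part of the complex, so every
   element of degree 0 is a cycle. *)
Definition dim_homology_K (K : fieldType) (n : nat) (F : free_seq K n)
    (i : nat) : nat :=
  match i with
  | 0 => rk F 0 - \rank (dif_K F 0)
  | j.+1 => \rank (kermx (dif_K F j)) - \rank (dif_K F j.+1)
  end%N.

Definition zero_seq (K : fieldType) (n : nat) : free_seq K n :=
  @FreeSeq K n (fun=> 0%N) 0 (fun=> 0).

(* Tor_i^S(I, K) is H_i(F (x)_S K) for a chosen resolution F of I by finitely
   generated free modules; [zero_seq] is only the default value required by
   [epsilon], every ideal of S having such a resolution. *)
Definition chosen_resolution (K : fieldType) (n : nat)
    (I : {mpoly K[n]} -> Prop) : free_seq K n :=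
  epsilon (inhabits (zero_seq K n)) (free_resolution I).

(* beta_i(I) = dim_K Tor_i^S(I, K). *)
Definition betti (K : fieldType) (n : nat) (I : {mpoly K[n]} -> Prop)
    (i : nat) : nat :=
  dim_homology_K (chosen_resolution I) i.

Definition simplicial_complex (W : finType) (D : {set {set W}}) : Prop :=
  set0 \in D /\
  forall A B : {set W}, A \in D -> B \subset A -> B \in D.

(* A face of dimension i has i + 1 elements. *)
Definition f_vector (W : finType) (D : {set {set W}}) (i : nat) : nat :=
  #|[set A in D | #|A| == i.+1]|.

(* Main.v *)
(* Write P_J for the generating polynomial of the ranks in a minimal free
   resolution of S / J.  If J : x_u y = L and L y is contained in J, then the lift
   of multiplication by x_u y to a map between the minimal resolutions of S / L
   and S / J can be taken divisible by x_u, so its cone is minimal and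
   P_(J + (x_u y)) = P_J + t P_L.  Adding a simplicial vertex u to a chordal graph
   adds the monomials x_u x_a, for a in the clique of neighbours of u, and each
   of them is such a step, whose colon ideal is I : x_a for the smaller graph.
   Cones that are not minimal still bound ranks from above; with them one shows
   P_(I : x_X) <= P_I coefficientwise by induction.  Finally, if p and q are face
   vectors of complexes (starting with the empty face) and q <= p, then so is
   p + t q: by Kruskal-Katona the compressed complex of q lies in that of p, and
   can be coned off with a new vertex.  Only the numerical side of
   Kruskal-Katona is needed for this. *)

Require Import Defs.
From Stdlib Require Import ClassicalEpsilon.
From mathcomp Require Import all_boot all_order all_algebra zify.
From mathcomp.multinomials Require Import mpoly.

Set Implicit Arguments.
Unset Strict Implicit.
Unset Printing Implicit Defensive.

Import GRing.Theory.

(** * Numerical Kruskal-Katona *)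

Section LeadCount.

Variable d : nat -> nat.

(* Among the first m sets of size k.+1 in colexicographic order, [lead_count m]
   is the number of those that contain the least element, when [d] gives the
   shadow sizes of colexicographic initial segments of sets of size k.  A set
   without the least element comes next exactly when its shadow fits into the
   sets that contain the least element. *)
Fixpoint lead_counts m : seq nat :=
  if m is m'.+1 then
    let l := lead_counts m' in
    let b := nth 0 l m' in
    let a := (m' - b).+1 in
    rcons l (if (a <= m') && (nth 0 l a + d (nth 0 l a) <= b) then b else b.+1)
  else [:: 0].

Definition lead_count m := nth 0 (lead_counts m) m.

(** Shadow of the first [m] sets of size k+1: deleting the least element from the leading sets gives
    [lead_count m] sets without it, and deleting another element gives [d (lead_count m)] sets with
    it. The shadow of the remaining sets adds nothing. *)
Definition lead_shadow m := lead_count m + d (lead_count m).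

Lemma size_lead_counts m : size (lead_counts m) = m.+1.
Proof. by elim: m => //= m IHm; rewrite size_rcons IHm. Qed.

Lemma nth_lead_counts m i : i <= m -> nth 0 (lead_counts m) i = lead_count i.
Proof.
elim: m => [|m IHm]; first by rewrite leqn0 => /eqP->.
rewrite leq_eqVlt => /predU1P[->//|ltim].
by rewrite /= nth_rcons size_lead_counts ltim IHm.
Qed.

Lemma lead_count_rec m :
  lead_count m.+1 =
    if ((m - lead_count m).+1 <= m) && (lead_shadow (m - lead_count m).+1 <= lead_count m)
    then lead_count m else (lead_count m).+1.
Proof.
rewrite {1}/lead_count /= nth_rcons size_lead_counts ltnn eqxx nth_lead_counts //.
by case: leqP => //= ltam; rewrite nth_lead_counts.
Qed.

Lemma lead_count_le m : lead_count m <= m.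
Proof. by elim: m => // m IHm; rewrite lead_count_rec; case: ifP => _; lia. Qed.

Lemma lead_countS m :
  lead_count m.+1 = if lead_shadow (m - lead_count m).+1 <= lead_count m
                    then lead_count m else (lead_count m).+1.
Proof.
have le := lead_count_le m; have := lead_count_rec m.
case: ltnP => //= ltm; have z : lead_count m = 0 by lia.
by rewrite /lead_shadow z subn0 => ->.
Qed.

Lemma lead_count1 : lead_count 1 = 1. Proof. by []. Qed.

Lemma lead_count_homo : {homo lead_count : m1 m2 / m1 <= m2}.
Proof.
apply: (@homo_leq nat _ (fun x y => x <= y)) => [//|y x z|m]; first exact: leq_trans.
by rewrite lead_countS; case: ifP.
Qed.

Lemma lead_count_subhomo : {homo (fun m => m - lead_count m) : m1 m2 / m1 <= m2}.
Proof.
apply: (@homo_leq nat _ (fun x y => x <= y)) => [//|y x z|m]; first exact: leq_trans.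
by rewrite lead_countS; case: ifP => _; lia.
Qed.

Lemma lead_count_gt0 m : 0 < m -> 0 < lead_count m.
Proof. by move=> m_gt0; rewrite -lead_count1 lead_count_homo. Qed.

Hypotheses (d0 : d 0 = 0) (d_homo : {homo d : m1 m2 / m1 <= m2}).

Lemma lead_shadow_homo : {homo lead_shadow : m1 m2 / m1 <= m2}.
Proof. by move=> m1 m2 le12; rewrite leq_add ?d_homo ?lead_count_homo. Qed.

Lemma lead_shadow_sub m : lead_shadow (m - lead_count m) <= lead_count m.
Proof.
elim: m => [|m IHm]; first by rewrite /lead_shadow /= d0.
rewrite lead_countS; case: ifP => [le|_]; last by rewrite subSS ltnW.
by rewrite subSn // lead_count_le.
Qed.

(** A leading set is added only when the shadow of one more non-leading set would not fit, so
    leading sets never outrun that shadow. *)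
Lemma lead_count_le_shadow m a : m - lead_count m < a -> lead_count m <= lead_shadow a.
Proof.
move=> lta; apply: leq_trans _ (lead_shadow_homo lta).
elim: m {lta} => // m IHm; rewrite lead_countS; case: ifPn => [_|].
  by apply: leq_trans IHm _; rewrite lead_shadow_homo // subSn // lead_count_le.
by rewrite -ltnNge subSS.
Qed.

(** A count off in either direction changes the number of non-leading sets the opposite way, against
    [lead_count_le_shadow] or [lead_shadow_sub]. *)
Lemma lead_count_shadow a : lead_count (a + lead_shadow a) = lead_shadow a.
Proof.
set M := a + _; have leM := lead_count_le M; apply/eqP; rewrite eqn_leq; apply/andP; split.
  rewrite leqNgt; apply/negP => lt.
  by have := @lead_count_le_shadow M a; rewrite /M in leM lt *; lia.
rewrite leqNgt; apply/negP => lt.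
have : lead_shadow a <= lead_shadow (M - lead_count M).
  by apply: lead_shadow_homo; rewrite /M in leM lt *; lia.
by have := lead_shadow_sub M; lia.
Qed.

End LeadCount.

(* [shadow k m] is the size of the shadow of the first m sets of size k in
   colexicographic order, the lower bound in the Kruskal-Katona theorem. *)
Fixpoint shadow k : nat -> nat := if k is j.+1 then lead_shadow (shadow j) else fun=> 0.

(** The value for [k = 0] is 0 because the empty set contains no least element. *)
Definition lead k : nat -> nat := if k is j.+1 then lead_count (shadow j) else fun=> 0.

Lemma shadowS k m : shadow k.+1 m = lead k.+1 m + shadow k (lead k.+1 m).
Proof. by []. Qed.

Lemma shadow0 k : shadow k 0 = 0.
Proof. by elim: k => //= k IHk; rewrite /lead_shadow /= IHk. Qed.

Lemma shadow_homo k : {homo shadow k : m1 m2 / m1 <= m2}.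
Proof. by elim: k => //= k IHk; apply: lead_shadow_homo. Qed.

Lemma lead_homo k : {homo lead k : m1 m2 / m1 <= m2}.
Proof. by case: k => // k; apply: lead_count_homo. Qed.

Lemma lead_le k m : lead k m <= m.
Proof. by case: k => // k; apply: lead_count_le. Qed.

Lemma sub_lead_homo k : {homo (fun m => m - lead k m) : m1 m2 / m1 <= m2}.
Proof. by case: k => [|k]; [move=> ? ? /=; rewrite !subn0 | apply: lead_count_subhomo]. Qed.

Lemma shadow_sub_lead k m : shadow k (m - lead k m) <= lead k m.
Proof.
by case: k => // k; apply: lead_shadow_sub; apply: shadow0.
Qed.

(** By [shadowS] the shadow consists of [L = lead k.+1 m] sets together with [shadow k L] sets,
    which is exactly the balanced situation of [lead_count_shadow]. *)
Lemma lead_shadowS k m : lead k (shadow k.+1 m) = shadow k (lead k.+1 m).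
Proof.
case: k => // k; rewrite shadowS; apply: lead_count_shadow; first exact: shadow0.
exact: shadow_homo.
Qed.

Lemma shadowS_sub_lead k m : shadow k.+1 m - lead k (shadow k.+1 m) = lead k.+1 m.
Proof. by rewrite lead_shadowS shadowS addnK. Qed.

Lemma lead_le_shadow k m a : m - lead k.+1 m < a -> lead k.+1 m <= shadow k.+1 a.
Proof. by apply: lead_count_le_shadow; apply: shadow_homo. Qed.

(* Kruskal-Katona for the family made of the first a sets of size k.+1 and of
   the first b sets of size k with a new element adjoined. *)
Lemma shadow_add k a b : shadow k.+1 (a + b) <= maxn b (shadow k.+1 a) + shadow k b.
Proof.
have [m] := ubnP (a + b); elim: k m a b => [|k IHk].
  move=> _ a b _; rewrite addn0 shadowS addn0.
  case: (leqP (lead 1 (a + b)) b) => [|ltb]; first by move/leq_trans->; rewrite // leq_maxl.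
  by apply: leq_trans (leq_maxr _ _); apply: lead_le_shadow; have := lead_le 1 (a + b); lia.
elim=> // m IHm a b ltm; set b0 := lead k.+2 (a + b).
have [leb|ltb] := leqP b0 b.
  rewrite shadowS -/b0; apply: leq_add; first exact: leq_trans leb (leq_maxl _ _).
  exact: shadow_homo.
have le_b0 : b0 <= a + b := lead_le _ _.
have le_a : b0 <= shadow k.+2 a by apply: lead_le_shadow; rewrite -/b0; lia.
(* Since [b < b0 <= shadow k.+2 a], the maximum is the shadow of [a]. Both families are now split
   into leading and remaining sets. *)
apply: leq_trans (leq_add (leq_maxr _ _) (leqnn _)).
set a1 := lead k.+2 a; set b1 := lead k.+1 b.
have a1_gt0 : 0 < a1 by apply: lead_count_gt0; lia.
have le_a1 : a1 <= a := lead_le _ _.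
have le_b1 : b1 <= b := lead_le _ _.
have le_b : b <= shadow k.+2 a by lia.
have b1a1 : b1 <= shadow k.+1 a1 by rewrite -lead_shadowS; apply: lead_homo.
have b2a1 : b - b1 <= a1 by rewrite -[a1]shadowS_sub_lead; apply: (@sub_lead_homo k.+1).
have IH1 := IHk _ _ _ (ltnSn (a1 + b1)); rewrite (maxn_idPr b1a1) in IH1.
rewrite [shadow k.+2 a]shadowS -/a1 [shadow k.+1 b]shadowS -/b1.
(* If [b0] is at most [a1 + b1], the induction on [k] for [a1] and [b1] concludes. *)
have [le0|lt0] := leqP b0 (a1 + b1).
  by rewrite shadowS -/b0; have := @shadow_homo k.+1 _ _ le0; lia.
(* Otherwise the remaining sets, fewer in total because [a1 > 0], bound [b0] by [a1 + b1] through
   the inner induction: a contradiction. *)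
have : b0 <= shadow k.+2 ((a - a1) + (b - b1)) by apply: lead_le_shadow; rewrite -/b0; lia.
have : shadow k.+2 ((a - a1) + (b - b1))
         <= maxn (b - b1) (shadow k.+2 (a - a1)) + shadow k.+1 (b - b1).
  by apply: IHm; lia.
have := shadow_sub_lead k.+2 a; have := shadow_sub_lead k.+1 b; rewrite -/a1 -/b1.
by move=> *; exfalso; lia.
Qed.

(** * Face-count vectors and compressed complexes *)

Definition shift_add (p q : nat -> nat) (i : nat) : nat :=
  p i + if i is j.+1 then q j else 0.

(* [p k] counts the faces with k vertices. *)
Definition kk_vector (p : nat -> nat) : Prop :=
  p 0 <= 1 /\ forall k, shadow k.+1 (p k.+1) <= p k.

(** In each degree this is [shadow_add] with [a = p k.+1] and [b = q k]. *)
Lemma kk_shift_add p q :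
  kk_vector p -> kk_vector q -> (forall i, q i <= p i) -> kk_vector (shift_add p q).
Proof.
move=> [p0 pS] [q0 qS] le_qp; split=> [|k]; first by rewrite /shift_add addn0.
rewrite /shift_add; apply: leq_trans (shadow_add _ _ _) _.
apply: leq_add; first by rewrite geq_max le_qp pS.
by case: k => // k; apply: qS.
Qed.

(** Face counts of the link and the deletion of the least vertex in the compressed complex of
    [p]. *)
Definition link_vector (p : nat -> nat) k := lead k.+1 (p k.+1).
Definition deletion_vector (p : nat -> nat) k := p k - lead k (p k).

(** The left side counts the sets without the least element in the shadow of the faces with k+1
    vertices, and that shadow has at most [p k] members. *)
Lemma link_le_deletion p k : kk_vector p -> link_vector p k <= deletion_vector p k.
Proof.
by move=> [_ pS]; rewrite /link_vector -shadowS_sub_lead; apply: (@sub_lead_homo k).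
Qed.

Lemma kk_link p : kk_vector p -> kk_vector (link_vector p).
Proof.
move=> [p0 pS]; split=> [|k]; last by rewrite -lead_shadowS lead_homo.
by apply: leq_trans p0; apply: leq_trans (pS 0); rewrite shadowS addn0.
Qed.

Lemma kk_deletion p : kk_vector p -> kk_vector (deletion_vector p).
Proof.
move=> pkk; have [p0 _] := pkk; split=> [|k]; first by rewrite /deletion_vector subn0.
by apply: leq_trans (link_le_deletion k pkk); apply: shadow_sub_lead.
Qed.

Lemma card_pair_sets (W : finType) (D1 D0 : {set {set W}}) i :
  #|[set A : {set option W} |
      (if None \in A then Some @^-1: A \in D1 else Some @^-1: A \in D0) & #|A| == i]|
  = (if i is j.+1 then #|[set B in D1 | #|B| == j]| else 0) + #|[set B in D0 | #|B| == i]|.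
Proof.
have preS (B : {set W}) : Some @^-1: (Some @: B) = B.
  by apply/setP=> w; rewrite inE mem_imset // => ? ? [].
have preNS (B : {set W}) : Some @^-1: (None |: Some @: B) = B.
  by apply/setP=> w; rewrite !inE mem_imset // => ? ? [].
have NoneS (B : {set W}) : None \in Some @: B = false by apply/imsetP=> -[].
have setSome (A : {set option W}) : A :\ None = Some @: (Some @^-1: A).
  apply/setP=> -[w|]; rewrite !inE ?NoneS //.
  by rewrite mem_imset ?inE // => ? ? [].
have cardS (B : {set W}) : #|Some @: B| = #|B| by apply: card_imset => ? ? [].
have inj1 : injective (fun B : {set W} => None |: Some @: B).
  move=> B C /(congr1 (fun A : {set option W} => Some @^-1: A)); by rewrite !preNS.
have inj0 : injective (fun B : {set W} => Some @: B).
  move=> B C /(congr1 (fun A : {set option W} => Some @^-1: A)); by rewrite !preS.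
pose X := [set A : {set option W} |
  (if None \in A then Some @^-1: A \in D1 else Some @^-1: A \in D0) & #|A| == i].
rewrite -/X -(cardsID [set A : {set option W} | None \in A] X); congr (_ + _).
  case: i @X => [|j] X.
    apply/eqP; rewrite cards_eq0 -subset0; apply/subsetP=> A; rewrite !inE.
    by move=> /andP[/andP[_ /eqP/cards0_eq->]]; rewrite inE.
  rewrite -(card_imset _ inj1); apply: eq_card => A; rewrite !inE.
  apply/idP/imsetP=> [/andP[/andP[] ]|[B]].
    move=> + + NA; rewrite NA => AD; rewrite (cardsD1 None) NA setSome cardS eqSS => cA.
    by exists (Some @^-1: A); rewrite ?inE ?AD // -setSome setD1K.
  by rewrite inE => /andP[BD cB] ->; rewrite preNS !inE eqxx BD cardsU1 NoneS cardS eqSS cB.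
rewrite -(card_imset _ inj0); apply: eq_card => A; rewrite !inE.
apply/idP/imsetP=> [/andP[NA]|[B]].
  rewrite (negbTE NA) => /andP[AD]; rewrite (cardsD1 None) (negbTE NA) setSome cardS => cA.
  by exists (Some @^-1: A); rewrite ?inE ?AD // -setSome; apply/setP=> -[w|]; rewrite !inE ?(negbTE NA).
by rewrite inE => /andP[BD cB] ->; rewrite preS NoneS BD cardS cB.
Qed.

(* The compressed complex of p: faces through the new vertex [None] form the
   compressed complex of [link_vector p], the others that of
   [deletion_vector p], and the former is contained in the latter. *)
Lemma compressed_complexes N :
  exists (W : finType) (D : (nat -> nat) -> {set {set W}}), forall p, kk_vector p ->
    [/\ forall q, (forall i, q i <= p i) -> D q \subset D p,
        forall A B : {set W}, A \in D p -> B \subset A -> B \in D p &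
        forall i, p i = 0 \/ i + p i <= N.+1 -> #|[set A in D p | #|A| == i]| = p i].
Proof.
elim: N => [|N [W [D DP]]].
  exists void, (fun p => if 0 < p 0 then setT else set0) => p [p0 pS]; split.
  - move=> q /(_ 0); case: (posnP (q 0)) => [->|q_gt0 le_qp]; first by rewrite sub0set.
    by rewrite (leq_trans q_gt0 le_qp) subsetT.
  - by move=> A B; case: ifP => _; rewrite !inE.
  move=> i pi.
  have -> : [set A : {set void} in (if 0 < p 0 then setT else set0) | #|A| == i]
          = if (0 < p 0) && (i == 0) then [set set0] else set0 :> {set {set void}}.
    apply/setP=> A; have -> : A = set0 by apply/setP=> -[].
    case: (0 < p 0); rewrite !inE ?cards0 //= eq_sym.
    by case: eqP; rewrite !inE ?eqxx.
  case: i pi => [|i] pi; last by rewrite andbF cards0; lia.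
  by rewrite andbT; case: posnP => [->|]; rewrite ?cards0 ?cards1 //; lia.
exists (option W), (fun p => [set A : {set option W} |
  if None \in A then Some @^-1: A \in D (link_vector p)
  else Some @^-1: A \in D (deletion_vector p)]) => p pkk.
have [mono1 down1 card1] := DP _ (kk_link pkk).
have [mono0 down0 card0] := DP _ (kk_deletion pkk).
split.
- move=> q le_qp; apply/subsetP=> A; rewrite !inE.
  case: ifP => _; apply/subsetP; first by apply: mono1 => i; apply: lead_homo.
  by apply: mono0 => i; apply: (@sub_lead_homo i).
- move=> A B; rewrite !inE => AD sBA.
  have sBA' : Some @^-1: B \subset Some @^-1: A by apply: preimsetS.
  move: AD; case: (boolP (None \in B)) => [/(subsetP sBA) -> AD|_]; first exact: down1 AD sBA'.
  case: ifP => _ AD; last exact: down0 AD sBA'.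
  (* Here [B] has lost the vertex [None] of [A], so the link must lie inside the deletion. *)
  have /subsetP -> // := mono0 (link_vector p) (fun i => link_le_deletion i pkk).
  exact: down1 AD sBA'.
move=> i pi.
have -> : forall P : {set option W} -> bool,
    [set A in [set A | P A] | #|A| == i] = [set A | P A & #|A| == i].
  by move=> P; apply/setP=> A; rewrite !inE.
rewrite card_pair_sets.
have [p0 _] := pkk.
case: i pi => [|i] pi.
  by rewrite card0 /deletion_vector ?subn0 //; lia.
have le := lead_le i.+1 (p i.+1).
(* The size condition descends: the link has one vertex less per face, and the deletion has at least
   one face less because some face is leading. *)
have gt : 0 < p i.+1 -> 0 < lead i.+1 (p i.+1) by apply: lead_count_gt0.
rewrite card1 ?card0 /link_vector /deletion_vector; lia.
Qed.

Lemma kk_complex p N :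
  kk_vector p -> p 0 = 1 -> (forall i, N <= i -> p i = 0) ->
  exists (W : finType) (D : {set {set W}}),
    simplicial_complex D /\ forall i, #|[set A in D | #|A| == i]| = p i.
Proof.
move=> pkk p0 pN.
(* This parameter bounds [i + p i] for every [i < N] at once. *)
have [W [D /(_ p pkk) [_ down cardD]]] := compressed_complexes (N + \sum_(i < N) p i).
have {}cardD i : #|[set A in D p | #|A| == i]| = p i.
  apply: cardD; case: (leqP N i) => [/pN->|ltiN]; first by left.
  by right; rewrite (bigD1 (Ordinal ltiN)) //=; lia.
exists W, (D p); split=> //; split=> //.
have /card_gt0P[A] : 0 < #|[set A in D p | #|A| == 0]| by rewrite cardD p0.
by rewrite inE => /andP[AD /eqP/cards0_eq A0]; rewrite -A0.
Qed.

(** * Simplicial vertices of chordal graphs *)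

Section Paths.

Variables (V : finType) (e : rel V).

Definition path_via (P : pred V) (a b : V) (w : seq V) : bool :=
  [&& path e a w, last a w == b, uniq (a :: w) & all (fun v => (v == b) || P v) w].

Lemma path_via_shortcut P a b w y z :
  path_via P a b w -> y \in a :: w -> z \in a :: w -> e y z ->
  (index y (a :: w)).+1 < index z (a :: w) ->
  exists2 w', path_via P a b w' & size w' < size w.
Proof.
move=> /and4P[pw /eqP lw uw allw]; set s := a :: w => ys zs eyz.
have lej : index z s <= size w by rewrite -ltnS -[(size w).+1]/(size s) index_mem.
move: (index y s) (index z s) (nth_index a ys) (nth_index a zs) lej.
move=> i [//|j] yE zE lej; rewrite ltnS => ltij.
have dropj : drop j w = z :: drop j.+1 w by rewrite (drop_nth a) // -[nth a w j]/(nth a s j.+1) zE.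
have last_take k v : nth a s k = v -> k <= size w -> last a (take k w) = v.
  move=> <-; case: k => [|k] lek; first by rewrite take0.
  by rewrite (last_nth a) size_takel //= nth_take.
have lastj := last_take _ _ zE lej.
(* Positions in [a :: w] exceed those in [w] by one: [take i w] ends at [y], and [drop j w] starts
   at [z]. *)
exists (take i w ++ drop j w); last by rewrite size_cat size_takel ?size_drop; lia.
have sub : subseq (take i w ++ drop j w) w.
  rewrite -[X in subseq _ X](cat_take_drop j); apply: cat_subseq => //.
  by rewrite -(@take_takel _ _ j) ?take_subseq // ltnW.
apply/and4P; split.
- rewrite cat_path take_path // (last_take i y) //=; last by lia.
  rewrite dropj /= eyz; move: pw; rewrite -{1}(cat_take_drop j.+1 w) cat_path lastj.
  by case/andP.
- by rewrite last_cat dropj /= -lastj -last_cat cat_take_drop lw.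
- by apply: subseq_uniq uw; rewrite /= eqxx.
- by apply/allP=> v /(mem_subseq sub)/(allP allw).
Qed.

(** An edge between non-consecutive vertices would give a shortcut, so a path of minimal length is
    induced. *)
Lemma shortest_path_via P a b w0 :
  path_via P a b w0 ->
  exists2 w, path_via P a b w &
    forall y z, y \in a :: w -> z \in a :: w -> e y z ->
      index y (a :: w) < index z (a :: w) -> index z (a :: w) = (index y (a :: w)).+1.
Proof.
have [m] := ubnP (size w0); elim: m w0 => // m IHm w0 ltm w0P.
have [[w w_lt wP]|no_shorter] :
  (exists2 w, size w < size w0 & path_via P a b w) \/
  ~ (exists2 w, size w < size w0 & path_via P a b w).
- pose Q := [exists k : 'I_(size w0), exists t : k.-tuple V, path_via P a b t].
  case: (boolP Q) => [/existsP[k /existsP[t tP]]|nQ]; [left | right].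
    by exists t; rewrite ?size_tuple.
  case=> w w_lt wP; case/negP: nQ; apply/existsP; exists (Ordinal w_lt).
  by apply/existsP; exists (in_tuple w).
- by apply: (IHm w) => //; lia.
exists w0 => // y z ys zs eyz lt; apply/eqP; rewrite eqn_leq lt andbT leqNgt.
apply/negP=> /(path_via_shortcut w0P ys zs eyz)[w wP w_lt].
by apply: no_shorter; exists w.
Qed.

End Paths.

(** * Dirac's theorem on simplicial vertices *)

Section Dirac.

Variables (V : finType) (e : rel V).
Hypotheses (e_sym : ssrbool.symmetric e) (e_irr : irreflexive e) (e_chordal : chordal e).
Implicit Types (U : {set V}) (x y u : V).

Definition simplicial U u : Prop :=
  forall y z, y \in U -> z \in U -> e u y -> e u z -> y != z -> e y z.

(* A shortest path from a to b through C closes up with x to a chordless cycle. *)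
Lemma no_path_via_nonneighbours (C : pred V) x a b w :
  (forall v, C v -> ~~ e x v) -> ~~ C x -> e x a -> e x b -> a != b -> ~~ e a b ->
  ~~ path_via e C a b w.
Proof.
move=> xC Cx xa xb ab nab; apply/negP=> /shortest_path_via[{}w /and4P[pw /eqP lw uw allw] short].
set s := a :: w in short uw.
have xs : x \notin s.
  rewrite inE; apply/norP; split; first by apply: contraTneq xa => <-; rewrite e_irr.
  apply/negP=> /(allP allw)/orP[/eqP xE|]; last by apply/negP.
  by rewrite xE e_irr in xb.
(* The closed cycle through [x] then has at least four vertices. *)
have size_w : 1 < size w.
  move: pw lw; clear -ab nab; case: w => [|v [|? ?]] //=.
    by move=> _ abE; rewrite abE eqxx in ab.
  by move=> /andP[av _] vb; rewrite -vb av in nab.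
have cyc : ucycle e (x :: s).
  by apply/andP; split; rewrite ?cons_uniq ?xs //= rcons_path xa pw lw e_sym.
have nbr v : v \in s -> e x v -> v = a \/ v = b.
  rewrite inE => /predU1P[->|/(allP allw)/orP[/eqP->|/xC/negbTE->//]]; first by left.
  by right.
(* The default value [x] of [nth] makes the successor of the last vertex [b] equal to [x], closing
   the cycle. *)
have nextE v : v \in s -> next (x :: s) v = nth x s (index v s).+1.
  move=> vs; have xv : x != v by apply: contraNneq xs => ->.
  by rewrite next_nth inE vs orbT /= (negbTE xv).
have nextx : next (x :: s) x = a by rewrite next_nth mem_head /= eqxx.
have nextb : next (x :: s) b = x.
  have bs : b \in s by rewrite -lw mem_last.
  by rewrite nextE // -{1}lw index_last // nth_default.
have nextP y z : y \in s -> z \in s -> e y z -> index y s < index z s -> z = next (x :: s) y.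
  by move=> ys zs eyz lt; rewrite nextE // -(short y z) // nth_index.
have [|y [z [yc zc eyz /eqP zy /eqP yz]]] := e_chordal cyc; first exact: size_w.
move: yc zc; rewrite !(in_cons x s) => /predU1P[yx|ys] /predU1P[zx|zs].
- by rewrite yx zx e_irr in eyz.
- rewrite yx in eyz zy yz; case: (nbr _ zs eyz) => zE; first by rewrite zE nextx in zy.
  by rewrite zE nextb in yz.
- rewrite zx e_sym in eyz zy yz; case: (nbr _ ys eyz) => yE; first by rewrite yE nextx in yz.
  by rewrite yE nextb in zy.
case: (ltngtP (index y s) (index z s)) => [lt|lt|eqi].
- by apply: zy; apply: nextP.
- by apply: yz; apply: nextP => //; rewrite e_sym.
by rewrite -(nth_index a ys) eqi nth_index // e_irr in eyz.
Qed.

(** Prescribing a vertex [x] to be avoided makes the induction on the size of [U] work: a component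
    of the non-neighbours of [x], with its boundary, is smaller, and the boundary is a clique. *)
Lemma dirac U x : x \in U ->
  (forall y, y \in U -> y != x -> e x y) \/
  exists u, [/\ u \in U, u != x, ~~ e x u & simplicial U u].
Proof.
have [m] := ubnP #|U|; elim: m U x => // m IHm U x ltm xU.
case: (boolP [exists y in U, (y != x) && ~~ e x y]) => [|/exists_inPn nex]; last first.
  by left=> y yU yx; move: (nex y yU); rewrite yx negbK.
case/exists_inP=> y0 y0U /andP[y0x xy0]; right.
pose M := [set y in U | (y != x) && ~~ e x y].
pose eM := [rel p q | [&& e p q, p \in M & q \in M]].
(* [C] is the component of [y0] among the non-neighbours of [x]; the set [A] below separates it from
   [x]. *)
pose C := [set c in M | connect eM y0 c].
pose A := [set a in U | e x a && [exists c in C, e a c]].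
have y0C : y0 \in C by rewrite !inE y0U y0x xy0 connect0.
have CP c : c \in C -> [/\ c \in U, c != x, ~~ e x c & connect eM y0 c].
  by rewrite !inE => /andP[/and3P[]].
have AP a : a \in A -> [/\ a \in U, e x a & exists2 c, c \in C & e a c].
  by rewrite inE => /and3P[aU xa /exists_inP].
have CA c y : c \in C -> y \in U -> e c y -> y \in C :|: A.
  move=> cC yU cy; have [cU cx xc y0c] := CP _ cC.
  have yx : y != x by apply: contraNneq xc => <-; rewrite e_sym.
  rewrite inE; case: (boolP (e x y)) => xy.
    by apply/orP; right; rewrite inE yU xy; apply/exists_inP; exists c; rewrite // e_sym.
  apply/orP; left; rewrite !inE yU yx xy /=; apply: connect_trans y0c (connect1 _).
  by rewrite /= cy !inE cU cx xc yU yx xy.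
have Aclique a b : a \in A -> b \in A -> a != b -> e a b.
  move=> /AP[aU xa [c cC ac]] /AP[bU xb [d dC bd]] ab; apply: contraT => nab.
  have [cU cx xc y0c] := CP _ cC; have [dU dx xd y0d] := CP _ dC.
  have symM : connect_sym eM.
    by apply: sym_connect_sym => p q /=; rewrite e_sym; case: (p \in M); rewrite !(andbT, andbF).
  have /connectP[w0 w0P lw0] : connect eM c d by apply: connect_trans y0d; rewrite symM.
  case/shortenP: w0P lw0 => w wP uw _ lw.
  have wM : all (mem M) w.
    elim: w c wP {uw lw ac cC cU cx xc y0c} => //= v w IHw c /andP[/and3P[_ _ vM] wP].
    by rewrite vM (IHw v).
  have wC v : v \in c :: w -> v \in C.
    move=> vw; rewrite inE (connect_trans y0c (path_connect wP vw)) andbT.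
    by move: vw; rewrite inE => /predU1P[->|/(allP wM)//]; rewrite !inE cU cx.
  have CN v : v \in C -> ~~ e x v by case/CP.
  have xC : x \notin C by apply/negP=> /CP[_ /eqP].
  case/negP: (no_path_via_nonneighbours (c :: rcons w b) CN xC xa xb ab nab).
  have notC v : e x v -> v \notin C by move=> xv; apply/negP=> /CN; rewrite xv.
  have eM_e : subrel eM e by move=> p q /= /and3P[].
  apply/and4P; split.
  - by rewrite /= ac rcons_path (sub_path eM_e wP) -lw e_sym.
  - by rewrite /= last_rcons.
  - have nw v : e x v -> v \notin c :: w by move=> xv; apply: contra (notC _ xv); apply: wC.
    by rewrite -rcons_cons cons_uniq rcons_uniq mem_rcons in_cons (negbTE ab) !nw.
  by rewrite -rcons_cons all_rcons eqxx andTb; apply/allP=> v /wC vC; apply/orP; right.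
have x_notin : x \notin C :|: A.
  by rewrite inE negb_or; apply/andP; split; apply/negP; [case/CP=> _ /eqP | case/AP; rewrite e_irr].
have sCU : C \subset C :|: A := subsetUl C A.
have sU'U : C :|: A \subset U by apply/subsetP=> y; rewrite in_setU => /orP[/CP[]|/AP[]].
have ltU' : #|C :|: A| < m.
  rewrite -ltnS; apply: leq_trans ltm; rewrite ltnS; apply: proper_card.
  by apply/properP; split=> //; exists x.
(* All neighbours in [U] of a vertex of [C] lie in [C :|: A], so simpliciality there suffices. *)
have lift_simplicial c : c \in C -> simplicial (C :|: A) c ->
    exists u, [/\ u \in U, u != x, ~~ e x u & simplicial U u].
  move=> cC simp_c; have [cU cx xc _] := CP _ cC; exists c; split=> // y z yU zU cy cz.
  by apply: simp_c => //; apply: (CA c).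
case: (boolP [exists a in A, exists y in C :|: A, (y != a) && ~~ e a y]).
  case/exists_inP=> a aA /exists_inP[y yU' /andP[ya ay]].
  have [|univ|[u [uU' ua au simp_u]]] := IHm _ a ltU'; first by rewrite inE aA orbT.
    by rewrite univ in ay.
  apply: (lift_simplicial u) => //; move: uU'; rewrite in_setU => /orP[//|uA].
  (* The vertex found avoids [a], so it cannot lie in the clique [A]. *)
  by rewrite Aclique // eq_sym in au.
move=> /exists_inPn nexA.
have Auniv a y : a \in A -> y \in C :|: A -> y != a -> e a y.
  by move=> /nexA/exists_inPn/(_ y) H yU' ya; move: (H yU'); rewrite ya negbK.
have ltC : #|C| < m by apply: leq_ltn_trans ltU'; apply: subset_leq_card.
(* The vertices of [A] are now adjacent to everything in [C :|: A], so only pairs inside [C] need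
   checking. *)
have lift c : c \in C -> simplicial C c -> simplicial (C :|: A) c.
  move=> cC simp_c y z yU' zU' cy cz yz.
  case: (boolP (y \in A)) => [yA|nyA]; first by rewrite Auniv // eq_sym.
  case: (boolP (z \in A)) => [zA|nzA]; first by rewrite e_sym Auniv.
  by move: yU' zU'; rewrite !in_setU (negbTE nyA) (negbTE nzA) !orbF => *; apply: simp_c.
case: (boolP [exists c in C, exists y in C, (y != c) && ~~ e c y]).
  case/exists_inP=> c cC /exists_inP[y yC /andP[yc cy]].
  have [univ|[u [uC _ _ simp_u]]] := IHm _ c ltC cC; first by rewrite univ in cy.
  by apply: (lift_simplicial u) => //; apply: lift.
move=> /exists_inPn nexC; apply: (lift_simplicial y0) => //; apply: lift => // y z yC zC _ _ yz.
by move: (nexC y yC) => /exists_inPn/(_ z zC); rewrite eq_sym yz negbK.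
Qed.

Lemma exists_simplicial U : U != set0 -> exists2 u, u \in U & simplicial U u.
Proof.
case/set0Pn=> x xU.
case: (boolP [exists c in U, exists y in U, (y != c) && ~~ e c y]).
  case/exists_inP=> c cU /exists_inP[y yU /andP[yc cy]].
  have [univ|[u [uU _ _ simp_u]]] := dirac cU; last by exists u.
  by rewrite univ in cy.
move=> /exists_inPn nexU; exists x => // y z yU zU _ _ yz.
by move: (nexU y yU) => /exists_inPn/(_ z zU); rewrite eq_sym yz negbK.
Qed.

End Dirac.

(** * Free resolutions and mapping cones *)

Section Resolutions.

Local Open Scope ring_scope.

Variables (K : fieldType) (n : nat).
Local Notation S := {mpoly K[n]}.
Implicit Types (I J L : S -> Prop) (F G Q : free_seq K n).

(* A resolution of an ideal I is extended by S in degree 0, so that it becomes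
   a resolution of S / I; all indices are shifted by one. *)
Definition erk F (i : nat) : nat := if i is j.+1 then rk F j else 1.

Definition edif F (i : nat) : 'M[S]_(erk F i.+1, erk F i) :=
  match i with 0 => aug F | j.+1 => dif F j end.

Definition resolves I F : Prop :=
  (forall f : S, I f <-> exists v : 'rV_(erk F 1), v *m edif F 0 = f%:M) /\
  forall (i : nat) (v : 'rV_(erk F i.+1)),
    v *m edif F i = 0 <-> exists w : 'rV_(erk F i.+2), v = w *m edif F i.+1.

Lemma resolvesE I F : free_resolution I F <-> resolves I F.
Proof.
split=> [[imF ex0 exS]|[imF ex]].
  by split=> // -[|i] v; [apply: ex0 | apply: exS].
by split=> // [v|i v]; [apply: (ex 0) | apply: (ex i.+1)].
Qed.

Lemma eq_resolves I J F : (forall f, I f <-> J f) -> resolves I F -> resolves J F.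
Proof. by move=> eqIJ [imF ex]; split=> // f; rewrite -eqIJ. Qed.

Lemma edif_edif I F i : resolves I F -> edif F i.+1 *m edif F i = 0.
Proof.
move=> [_ ex]; apply/row_matrixP=> j; rewrite row_mul row0.
by apply/ex; exists (delta_mx 0 j); rewrite -rowE.
Qed.

Lemma exact_lift I F i m (A : 'M[S]_(m, erk F i.+1)) :
  resolves I F -> A *m edif F i = 0 ->
  exists B : 'M_(m, erk F i.+2), B *m edif F i.+1 = A.
Proof.
move=> [_ ex] A0.
have /fin_all_exists[w wE] j : exists w : 'rV_(erk F i.+2), row j A = w *m edif F i.+1.
  by apply/ex; rewrite -row_mul A0 row0.
by exists (\matrix_j w j); apply/row_matrixP=> j; rewrite row_mul rowK wE.
Qed.

(** Comparison theorem. The maps are chosen by [epsilon] without proof of existence, since each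
    existence statement needs the chain identity one degree below; the identities follow afterwards
    by induction. *)
Lemma chain_lift J F Q (phi0 : 'M[S]_(erk Q 0, erk F 0)) :
  resolves J F -> (forall i, edif Q i.+1 *m edif Q i = 0) ->
  (exists B : 'M_(erk Q 1, erk F 1), B *m edif F 0 = edif Q 0 *m phi0) ->
  exists2 phi : forall i, 'M[S]_(erk Q i, erk F i), phi 0 = phi0 &
    forall i, phi i.+1 *m edif F i = edif Q i *m phi i.
Proof.
move=> resF cxQ ex0.
pose phi := fix phi i : 'M[S]_(erk Q i, erk F i) :=
  match i with
  | 0 => phi0
  | j.+1 => epsilon (inhabits 0) (fun B => B *m edif F j = edif Q j *m phi j)
  end.
exists phi => // i.
apply: (epsilon_spec (inhabits 0) (fun B => B *m edif F i = edif Q i *m phi i)).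
case: i => [//|i]; apply: (exact_lift resF).
have: phi i.+1 *m edif F i = edif Q i *m phi i; last first.
  by move=> phiE; rewrite -mulmxA phiE mulmxA cxQ mul0mx.
elim: i => [|i IHi].
  exact: (epsilon_spec (inhabits 0) (fun B => B *m edif F 0 = edif Q 0 *m phi 0)).
apply: (epsilon_spec (inhabits 0) (fun B => B *m edif F i.+1 = edif Q i.+1 *m phi i.+1)).
by apply: (exact_lift resF); rewrite -mulmxA IHi mulmxA cxQ mul0mx.
Qed.

Lemma mult_lift J L F Q (c : S) :
  resolves J F -> resolves L Q -> (forall f, L f -> J (f * c)) ->
  exists2 phi : forall i, 'M[S]_(erk Q i, erk F i), phi 0 = c%:M &
    forall i, phi i.+1 *m edif F i = edif Q i *m phi i.
Proof.
move=> resF resQ LJ; apply: (chain_lift resF) => [i|]; first exact: edif_edif resQ.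
have /fin_all_exists[w wE] j :
    exists w : 'rV_(erk F 1), w *m edif F 0 = row j (edif Q 0 *m c%:M).
  have Lj : L (edif Q 0 j 0).
    apply/(proj1 resQ); exists (delta_mx 0 j).
    by rewrite -rowE; apply/matrixP=> a b; rewrite !ord1 !mxE eqxx mulr1n.
  have /(proj1 resF)[v vE] := LJ _ Lj; exists v; rewrite vE.
  by rewrite mul_mx_scalar; apply/matrixP=> a b; rewrite !ord1 !mxE eqxx mulr1n mulrC.
by exists (\matrix_j w j); apply/row_matrixP=> j; rewrite row_mul rowK wE.
Qed.

Lemma null_homotopic J F Q (al : forall i, 'M[S]_(erk Q i, erk F i)) :
  resolves J F -> (forall i, edif Q i.+1 *m edif Q i = 0) ->
  (forall i, al i.+1 *m edif F i = edif Q i *m al i) -> al 0 = 0 ->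
  exists h : forall i, 'M[S]_(erk Q i, erk F i.+1),
    forall i, al i.+1 = h i.+1 *m edif F i.+1 + edif Q i *m h i.
Proof.
move=> resF cxQ alE al0.
pose h := fix h i : 'M[S]_(erk Q i, erk F i.+1) :=
  match i with
  | 0 => 0
  | j.+1 => epsilon (inhabits 0)
             (fun B => B *m edif F j.+1 = al j.+1 - edif Q j *m h j)
  end.
have hE i : (al i.+1 - edif Q i *m h i) *m edif F i = 0 ->
    h i.+1 *m edif F i.+1 = al i.+1 - edif Q i *m h i.
  move=> /(exact_lift resF).
  exact: (epsilon_spec (inhabits 0)
            (fun B => B *m edif F i.+1 = al i.+1 - edif Q i *m h i)).
exists h => i; suff -> : h i.+1 *m edif F i.+1 = al i.+1 - edif Q i *m h i.
  by rewrite subrK.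
elim: i => [|i IHi]; apply: hE; rewrite mulmxBl alE.
  by rewrite al0 /= !mulmx0 mul0mx subr0.
rewrite -mulmxA IHi mulmxBr opprB addrCA subrr addr0.
by rewrite mulmxA cxQ mul0mx.
Qed.

(** With the augmented indexing, degree i+1 of the cone is degree i+1 of [F] plus degree i of [Q];
    degree 0 remains [S]. *)
Definition cone F Q (phi : forall i, 'M[S]_(erk Q i, erk F i)) : free_seq K n :=
  @FreeSeq K n (fun i => rk F i + erk Q i)%N
    (col_mx (aug F) (phi 0))
    (fun i => block_mx (dif F i) 0 (phi i.+1) (- edif Q i)).

(** The short exact sequence from S / (J : c) through S / J to S / (J + (c)) underlies this;
    exactness of the cone is checked by an explicit chase. *)
Lemma cone_resolves J L F Q (c : S) (phi : forall i, 'M[S]_(erk Q i, erk F i)) :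
  resolves J F -> resolves L Q -> (forall f, L f <-> J (f * c)) ->
  phi 0 = c%:M -> (forall i, phi i.+1 *m edif F i = edif Q i *m phi i) ->
  resolves (fun f => exists a, J (f - a * c)) (cone phi).
Proof.
move=> resF resQ colon phi0 phiE.
split=> [f|i v].
  split=> [[a /(proj1 resF)[v vE]]|[v]].
    exists (row_mx v a%:M); rewrite /= mul_row_col phi0 -scalar_mxM.
    have /= -> := vE; rewrite -raddfD /=; congr (_%:M); exact: subrK.
  rewrite -[v]hsubmxK /= mul_row_col phi0 => vE.
  exists (rsubmx v 0 0); apply/(proj1 resF); exists (lsubmx v).
  rewrite raddfB /= -vE [rsubmx v]mx11_scalar -scalar_mxM !mxE eqxx !mulr1n.
  by rewrite addrK.
split; last first.
  case=> w ->; rewrite -mulmxA.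
  suff -> : edif (cone phi) i.+1 *m edif (cone phi) i = 0 by rewrite mulmx0.
  case: i v w => [|i] v w /=.
    rewrite mul_block_col mul0mx addr0 (edif_edif 0 resF) mulNmx.
    by have /= -> := phiE 0; rewrite subrr col_mx0.
  have /= FF := edif_edif i.+1 resF; have /= QQ := edif_edif i resQ.
  rewrite mulmx_block FF; have /= -> := phiE i.+1.
  rewrite !mulmx0 !mul0mx !mulNmx !mulmxN opprK QQ !addr0 subrr.
  exact: block_mx0.
case: i v => [|i] v; rewrite -[v]hsubmxK; move: (lsubmx v) (rsubmx v) => x y.
  rewrite /= mul_row_col phi0 [y]mx11_scalar -scalar_mxM => xy0.
  (* In the lowest degree [c] times the entry of [y] lies in [J], and the colon hypothesis puts the
     entry into [L]. *)
  have /(proj1 resQ)[w wE] : L (y 0 0).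
    apply/colon/(proj1 resF); exists (- x); rewrite mulNmx.
    by apply/eqP; rewrite eq_sym -addr_eq0 addrC xy0.
  have /(proj2 resF 0)[z zE] : (x + w *m phi 1) *m edif F 0 = 0.
    by rewrite mulmxDl -mulmxA phiE mulmxA wE phi0 -scalar_mxM.
  exists (row_mx z (- w)); rewrite mul_row_block mulmx0 add0r mulNmx.
  rewrite mulmxN mulNmx opprK wE; congr row_mx.
  by have /= <- := zE; rewrite addrK.
rewrite /= mul_row_block mulmx0 add0r mulmxN -[0 in RHS]row_mx0.
move=> /eq_row_mx[xy0 /eqP]; rewrite oppr_eq0 => /eqP/(proj2 resQ)[w wE].
have /(proj2 resF i.+1)[z zE] : (x + w *m phi i.+2) *m edif F i.+1 = 0.
  by rewrite mulmxDl -mulmxA phiE mulmxA -wE.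
(* The sign compensates for [- edif Q], and the correction [w *m phi] contained in [z] cancels. *)
exists (row_mx z (- w)); rewrite mul_row_block mulmx0 add0r mulNmx.
rewrite mulmxN mulNmx opprK; congr row_mx; last exact: wE.
by have /= <- := zE; rewrite addrK.
Qed.

(** Both composites lift the identity of S / J, so they differ from the identity by null-homotopic
    maps. *)
Lemma homotopy_inverse J F G :
  resolves J F -> resolves J G ->
  exists (f : forall i, 'M[S]_(erk F i, erk G i))
         (g : forall i, 'M[S]_(erk G i, erk F i))
         (h : forall i, 'M[S]_(erk F i, erk F i.+1))
         (k : forall i, 'M[S]_(erk G i, erk G i.+1)),
    [/\ forall i, f i.+1 *m edif G i = edif F i *m f i,
        forall i, g i.+1 *m edif F i = edif G i *m g i,
        forall i, f i.+1 *m g i.+1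
          = 1%:M + (h i.+1 *m edif F i.+1 + edif F i *m h i) &
        forall i, g i.+1 *m f i.+1
          = 1%:M + (k i.+1 *m edif G i.+1 + edif G i *m k i)].
Proof.
move=> resF resG.
have JJ f : J f -> J (f * 1) by rewrite mulr1.
have [f f0 fE] := mult_lift resG resF JJ.
have [g g0 gE] := mult_lift resF resG JJ.
have [||h hE] := @null_homotopic J F F (fun i => f i *m g i - 1%:M) resF
  (fun i => edif_edif i resF).
- by move=> i; rewrite mulmxBl mulmxBr mul1mx mulmx1 -mulmxA gE !mulmxA fE.
- by rewrite f0 g0 -scalar_mxM mulr1 subrr.
have [||k kE] := @null_homotopic J G G (fun i => g i *m f i - 1%:M) resG
  (fun i => edif_edif i resG).
- by move=> i; rewrite mulmxBl mulmxBr mul1mx mulmx1 -mulmxA fE !mulmxA gE.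
- by rewrite f0 g0 -scalar_mxM mulr1 subrr.
by exists f, g, h, k; split=> // i; rewrite -?hE -?kE addrC subrK.
Qed.

(** * Minimal resolutions compared with arbitrary ones *)

Definition const_mx0 m p (A : 'M[S]_(m, p)) : 'M[K]_(m, p) := map_mx (mcoeff 0%MM) A.

Definition minimal F : Prop := forall i, const_mx0 (edif F i) = 0.

(** Modulo the variables the differentials of [F] vanish, so the homotopy on [F] disappears and [F]
    becomes a direct summand of [G], consisting of cycles. *)
Lemma minimal_section J F G :
  resolves J F -> resolves J G -> minimal F ->
  forall i, exists (f : 'M[K]_(erk F i.+1, erk G i.+1)) g,
    [/\ f *m g = 1%:M, f *m const_mx0 (edif G i) = 0,
        const_mx0 (edif G i.+1) *m g = 0 &
        exists (k : 'M[K]_(erk G i.+1, erk G i.+2)) k',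
          g *m f = 1%:M + (k *m const_mx0 (edif G i.+1) + const_mx0 (edif G i) *m k')].
Proof.
move=> resF resG minF i.
have [f [g [h [k [fE gE hE kE]]]]] := homotopy_inverse resF resG.
exists (const_mx0 (f i.+1)), (const_mx0 (g i.+1)); rewrite /const_mx0; split.
- rewrite -map_mxM hE !map_mxD !map_mxM map_mx1 -!/(const_mx0 _) !minF.
  by rewrite mul0mx mulmx0 !addr0.
- by rewrite -map_mxM fE map_mxM -!/(const_mx0 _) minF mul0mx.
- by rewrite -map_mxM -gE map_mxM -!/(const_mx0 _) minF mulmx0.
exists (const_mx0 (k i.+1)), (const_mx0 (k i)); rewrite /const_mx0.
by rewrite -map_mxM kE !map_mxD !map_mxM map_mx1.
Qed.

Lemma minimal_rank_le J F G i :
  resolves J F -> resolves J G -> minimal F -> (erk F i <= erk G i)%N.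
Proof.
case: i => // i resF resG minF.
by have [f [g [/mulmx1_min]]] := minimal_section resF resG minF i.
Qed.

(** On cycles [g] is onto, because [f] lands in the cycles and splits it; its kernel there is the
    space of boundaries. *)
Lemma minimal_homology J F G i :
  resolves J F -> resolves J G -> minimal F ->
  (\rank (kermx (const_mx0 (edif G i))) - \rank (const_mx0 (edif G i.+1)))%N = rk F i.
Proof.
move=> resF resG minF.
have [f [g [fg f0 g0 [k [k' gf]]]]] := minimal_section resF resG minF i.
set d := const_mx0 (edif G i) in f0 gf *; set d' := const_mx0 (edif G i.+1) in g0 gf *.
have d'd : d' *m d = 0.
  by rewrite /d /d' -map_mxM (edif_edif i resG); apply: map_mx0.
rewrite -(mxrank_mul_ker (kermx d) g).
have -> : \rank (kermx d *m g) = rk F i.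
  apply/eqP; rewrite eqn_leq rank_leq_col /= -[X in (X <= _)%N](mxrank1 K).
  by apply/mxrankS; rewrite -fg submxMr //; apply/sub_kermxP.
(* A cycle killed by [g] is a boundary, by the homotopy from [g *m f] to the identity. *)
suff /eqmx_rank -> : (kermx d :&: kermx g == d')%MS by rewrite addnK.
apply/andP; split; last first.
  by rewrite sub_capmx; apply/andP; split; apply/sub_kermxP.
set Z := (_ :&: _)%MS.
have Zd : Z *m d = 0 by apply/sub_kermxP/capmxSl.
have Zg : Z *m g = 0 by apply/sub_kermxP/capmxSr.
have : Z *m (g *m f) = 0 by rewrite mulmxA Zg mul0mx.
rewrite gf mulmxDr mulmx1 mulmxDr [Z *m (d *m _)]mulmxA Zd mul0mx addr0 => /eqP.
rewrite addr_eq0 => /eqP ->; rewrite mulmxA -mulNmx; exact: submxMl.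
Qed.

End Resolutions.

(** * Squarefree monomial ideals *)

Section SquarefreeIdeals.

Local Open Scope ring_scope.

Variables (K : fieldType) (V : finType).
Local Notation S := {mpoly K[#|V|]}.
Implicit Types (T : pred {set V}) (A W Y : {set V}) (m : 'X_{1..#|V|}) (p q : nat -> nat).

Definition vsupp m : {set V} := [set v | m (enum_rank v) != 0]%N.

Definition vmon A : 'X_{1..#|V|} := [multinom (enum_val i \in A : nat) | i < #|V|].

Lemma vsuppD m1 m2 : vsupp (m1 + m2)%MM = vsupp m1 :|: vsupp m2.
Proof. by apply/setP=> v; rewrite !inE mnmDE addn_eq0 negb_and. Qed.

Lemma vsupp_vmon A : vsupp (vmon A) = A.
Proof. by apply/setP=> v; rewrite inE mnmE enum_rankK eqb0 negbK. Qed.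

Lemma vmon_le A m : (vmon A <= m)%MM = (A \subset vsupp m).
Proof.
apply/mnm_lepP/subsetP => [le_Am v Av | Am i].
  by rewrite inE -lt0n (leq_trans _ (le_Am _)) // mnmE enum_rankK Av.
rewrite mnmE; case: (boolP (_ \in A)) => // /Am.
by rewrite inE enum_valK lt0n.
Qed.

Lemma vmonU1 v A : v \notin A -> vmon (v |: A) = (vmon [set v] + vmon A)%MM.
Proof.
move=> vA; apply/mnmP=> i; rewrite mnmDE !mnmE !inE.
by case: eqP => //= ->; rewrite (negbTE vA).
Qed.

(* The monomials x^m with [T (vsupp m)] span an ideal when T is upward closed;
   here this follows from the existence of a resolution. *)
Definition sqfree T (f : S) : Prop := forall m, m \in msupp f -> T (vsupp m).

Lemma eq_sqfree T T' f : T =1 T' -> sqfree T f <-> sqfree T' f.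
Proof. by move=> eqT; split=> Tf m /Tf; rewrite eqT. Qed.

(** This describes the colon ideal by x_A: multiplication by the monomial adds [A] to every
    support. *)
Lemma sqfreeM T A f :
  sqfree T (f * 'X_[vmon A]) <-> sqfree (fun W => T (W :|: A)) f.
Proof.
split=> Tf m mf.
  have := Tf (vmon A + m)%MM; rewrite (perm_mem (msuppMX _ _)) vsuppD vsupp_vmon setUC.
  by apply; apply/mapP; exists m.
move: mf; rewrite (perm_mem (msuppMX _ _)) => /mapP[m' /Tf Tm' ->].
by rewrite vsuppD vsupp_vmon setUC.
Qed.

Lemma sqfreeD T A f :
  sqfree (fun W => T W || (A \subset W)) f <-> exists a, sqfree T (f - a * 'X_[vmon A]).
Proof.
split=> [Tf|[a Ta] m mf].
  (* The witness is the quotient by x_A of the part of [f] whose terms are divisible by x_A. *)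
  exists (\sum_(m <- msupp f | A \subset vsupp m) f@_m *: 'X_[m - vmon A]).
  have -> : f - (\sum_(m <- msupp f | A \subset vsupp m) f@_m *: 'X_[m - vmon A]) * 'X_[vmon A]
          = \sum_(m <- msupp f | ~~ (A \subset vsupp m)) f@_m *: 'X_[m].
    rewrite {1}[f]mpolyE (bigID (fun m => A \subset vsupp m)) /= mulr_suml addrAC.
    rewrite [X in _ - X](eq_bigr (fun m => f@_m *: 'X_[m])) ?subrr ?add0r // => m.
    by rewrite -vmon_le -scalerAl -mpolyXD => /submK ->.
  move=> m /msupp_sum_le /flattenP[s /mapP[m']]; rewrite mem_filter => /andP[Am' fm'] ->.
  move=> /msuppZ_le; rewrite msuppX inE => /eqP->.
  by move: (Tf _ fm'); rewrite (negbTE Am') orbF.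
move: mf; rewrite -[f](subrK (a * 'X_[vmon A])) => /msuppD_le; rewrite mem_cat => /orP[/Ta ->//|].
rewrite (perm_mem (msuppMX _ _)) => /mapP[m' _ ->].
by rewrite vsuppD vsupp_vmon subsetUl orbT.
Qed.

Definition ranks T p : Prop :=
  exists F, [/\ resolves (sqfree T) F, minimal F & forall i, erk F i = p i].

(** Without minimality, [p] is only an upper bound for the ranks of a minimal resolution, by
    [ranks_le_bound]. *)
Definition rank_bound T p : Prop :=
  exists2 F, resolves (sqfree T) F & forall i, erk F i = p i.

Lemma ranks_bound T p : ranks T p -> rank_bound T p.
Proof. by case=> F [resF _ pF]; exists F. Qed.

Lemma eq_ranks T T' p q : T =1 T' -> p =1 q -> ranks T p -> ranks T' q.
Proof.
move=> eqT eqp [F [resF minF pF]]; exists F; split=> // [|i]; last by rewrite pF.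
by apply: eq_resolves resF => f; apply: eq_sqfree.
Qed.

Lemma eq_rank_bound T T' p q : T =1 T' -> p =1 q -> rank_bound T p -> rank_bound T' q.
Proof.
move=> eqT eqp [F resF pF]; exists F => [|i]; last by rewrite pF.
by apply: eq_resolves resF => f; apply: eq_sqfree.
Qed.

Lemma ranks_le_bound T p q i : ranks T p -> rank_bound T q -> (p i <= q i)%N.
Proof.
by move=> [F [resF minF <-]] [G resG <-]; apply: minimal_rank_le resF resG minF.
Qed.

Lemma ranks_pred0 : ranks pred0 (fun i => i == 0)%N.
Proof.
exists (zero_seq K #|V|); split; last by case.
  split=> [f|i v]; last first.
    have v0 : v = 0 by apply/matrixP=> ? [].
    by split=> _; [exists 0; rewrite mul0mx | rewrite v0 mul0mx].
  split=> [Tf|[v]].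
    exists 0; suff -> : f = 0 by rewrite mul0mx raddf0.
    apply/msuppnil0; case Ef: (msupp f) => [//|m s].
    by have := Tf m; rewrite Ef mem_head => /(_ isT).
  rewrite thinmx0 mul0mx => /matrixP/(_ 0 0); rewrite !mxE mulr1n => <- m.
  by rewrite msupp0.
by case=> [|i]; apply/matrixP=> - [].
Qed.

Lemma rank_bound_cone T T' (c : V) p q :
  rank_bound T p -> rank_bound T' q -> (forall W, T' W = T (c |: W)) ->
  rank_bound (fun W => T W || (c \in W)) (shift_add p q).
Proof.
move=> [F resF pF] [Q resQ qQ] colon.
have colonJ f : sqfree T' f <-> sqfree T (f * 'X_[vmon [set c]]).
  by rewrite sqfreeM; apply: eq_sqfree => W; rewrite colon setUC.
have [phi phi0 phiE] := mult_lift resF resQ (fun f => proj1 (colonJ f)).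
exists (cone phi) => [|[|i]]; last 2 first.
- by rewrite /shift_add -pF.
- by rewrite /shift_add -pF -qQ.
apply: eq_resolves (cone_resolves resF resQ colonJ phi0 phiE) => f.
by rewrite -sqfreeD; apply: eq_sqfree => W; rewrite sub1set.
Qed.

(** The last hypothesis says that x_Y alone carries the colon ideal by x_u x_Y into the ideal of
    [T]; this is what keeps the cone minimal. [Y] may be empty, which adjoins the variable x_u. *)
Lemma ranks_cone T T' (u : V) Y p q :
  ranks T p -> ranks T' q -> u \notin Y ->
  (forall W, T' W = T (u |: Y :|: W)) -> (forall W, T' W -> T (Y :|: W)) ->
  ranks (fun W => T W || (u |: Y \subset W)) (shift_add p q).
Proof.
move=> [F [resF minF pF]] [Q [resQ minQ qQ]] uY colon liftY.
have colonJ f : sqfree T' f <-> sqfree T (f * 'X_[vmon (u |: Y)]).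
  by rewrite sqfreeM; apply: eq_sqfree => W; rewrite colon setUC.
have liftJ f : sqfree T' f -> sqfree T (f * 'X_[vmon Y]).
  by rewrite sqfreeM => Tf m /Tf /liftY; rewrite setUC.
(* Multiplication by x_u kills the constant terms of the lift of x_Y. *)
have [psi psi0 psiE] := mult_lift resF resQ liftJ.
pose phi i := 'X_[vmon [set u]] *: psi i.
have phi0 : phi 0 = ('X_[vmon (u |: Y)])%:M.
  by rewrite /phi psi0 vmonU1 // mpolyXD scale_scalar_mx.
have phiE i : phi i.+1 *m edif F i = edif Q i *m phi i.
  by rewrite -scalemxAl psiE scalemxAr.
have minphi i : const_mx0 (phi i) = 0.
  apply/matrixP=> a b; rewrite !mxE rmorphM /= mcoeffX.
  case: eqP => [/(congr1 vsupp)|]; last by rewrite mul0r.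
  rewrite vsupp_vmon => /setP/(_ u); rewrite !inE eqxx => /esym.
  by rewrite mnm0E.
exists (cone phi); split=> [||[|i]]; last 2 first.
- by rewrite /shift_add -pF.
- by rewrite /shift_add -pF -qQ.
- apply: eq_resolves (cone_resolves resF resQ colonJ phi0 phiE) => f.
  by rewrite -sqfreeD; apply: eq_sqfree.
case=> [|i]; rewrite /const_mx0.
  rewrite map_col_mx; have := minF 0; have := minphi 0; rewrite /const_mx0 => /= -> ->.
  exact: col_mx0.
rewrite map_block_mx map_mxN; have /= := minF i.+1; have := minphi i.+1; have := minQ i.
rewrite /const_mx0 => -> -> ->; rewrite map_mx0 oppr0; exact: block_mx0.
Qed.

End SquarefreeIdeals.

(** * Colon ideals of chordal edge ideals *)

Definition face_vector (p : nat -> nat) : Prop :=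
  kk_vector p /\ exists N, forall i, N <= i -> p i = 0.

Lemma face_vector1 : face_vector (fun i => i == 0).
Proof.
split; last by exists 1 => -[].
by split=> [|k] //; rewrite shadow0.
Qed.

Lemma face_shift_add p q :
  face_vector p -> face_vector q -> (forall i, q i <= p i) -> face_vector (shift_add p q).
Proof.
move=> [pkk [M pM]] [qkk [N qN]] le_qp; split; first exact: kk_shift_add.
exists (M + N.+1) => -[|i] lei; rewrite /shift_add ?pM ?qN //; lia.
Qed.

Definition shift_adds (V : Type) (q : V -> nat -> nat) (p : nat -> nat) (s : seq V) :=
  foldr (fun a r => shift_add r (q a)) p s.

Lemma shift_addsE (V : Type) (q : V -> nat -> nat) p s i :
  shift_adds q p s i = p i + if i is j.+1 then \sum_(a <- s) q a j else 0.
Proof.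
elim: s => [|a s IHs] /=; first by case: i => [|j]; rewrite ?big_nil addn0.
by rewrite /shift_add IHs; case: i {IHs} => [|j]; rewrite ?addn0 // big_cons; lia.
Qed.

(** Each [q a] stays below every partial sum, since the partial sums only grow from [p]. *)
Lemma face_shift_adds (V : eqType) (q : V -> nat -> nat) p s :
  face_vector p -> (forall a, a \in s -> face_vector (q a)) ->
  (forall a i, a \in s -> q a i <= p i) -> face_vector (shift_adds q p s).
Proof.
elim: s => //= a s IHs fp fq le_qp; apply: face_shift_add.
- by apply: IHs => // [b bs|b i bs]; [apply: fq | apply: le_qp]; rewrite inE bs orbT.
- by apply: fq; rewrite mem_head.
by move=> i; rewrite shift_addsE; apply: leq_trans (le_qp a i (mem_head _ _)) (leq_addr _ _).
Qed.

(** The generating polynomial is multiplied by (1 + t)^k, as by the Koszul complex on k new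
    variables. *)
Definition doubling k : (nat -> nat) -> nat -> nat := iter k (fun r => shift_add r r).

Lemma face_doubling k p : face_vector p -> face_vector (doubling k p).
Proof. by move=> fp; elim: k => //= k IHk; apply: face_shift_add. Qed.

Lemma doubling_le k p q i : (forall j, p j <= q j) -> doubling k p i <= doubling k q i.
Proof.
by move=> le_pq; elim: k i => //= k IHk [|i]; rewrite /shift_add leq_add.
Qed.

Section Colons.

Variables (K : fieldType) (V : finType).
Implicit Types (T : pred {set V}) (X W : {set V}) (s : seq V) (p : nat -> nat).

Definition upward T : Prop := forall W W', W \subset W' -> T W -> T W'.

(** The generators x_u x_a are adjoined one at a time; for [a] in [X] the generator is x_u alone,
    because x_X has been divided out. *)
Lemma ranks_edges T X (u : V) s p (q : V -> nat -> nat) :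
  upward T -> (forall W, T (X :|: W) = T W) -> (forall W, T (u |: W) = T W) ->
  u \notin s -> uniq s ->
  (forall a b W, a \in s -> b \in s -> a != b -> a \in W -> b \in W -> T W) ->
  ranks K T p -> (forall a, a \in s -> ranks K (fun W => T (a |: W)) (q a)) ->
  u \notin X ->
  ranks K (fun W => T W || (u \in W) && has (mem (X :|: W)) s) (shift_adds q p s).
Proof.
move=> upT TX Tu us uniq_s sT Tp Tq uX.
elim: s us uniq_s sT Tq => [|a s IHs] /= us uniq_s sT Tq.
  by apply: eq_ranks Tp => // W; rewrite andbF orbF.
move: us uniq_s; rewrite inE negb_or => /andP[ua us] /andP[a_s uniq_s].
have {}IHs : ranks K (fun W => T W || (u \in W) && has (mem (X :|: W)) s) (shift_adds q p s).
  apply: IHs => // [b c W bs cs|b bs]; last by apply: Tq; rewrite inE bs orbT.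
  by apply: sT; rewrite inE ?bs ?cs orbT.
have TY W : T (([set a] :\: X) :|: W) = T (a |: W).
  rewrite -TX setUA -(TX (a |: W)) setUA; congr (T (_ :|: W)).
  by apply/setP=> v; rewrite !inE; case: (v \in X).
have := ranks_cone (u := u) (Y := [set a] :\: X) IHs (Tq a (mem_head _ _)).
case=> [|W|W|F [resF minF pF]].
- by rewrite !inE (negbTE ua) andbF.
(* For other [b] in [s] the product x_a x_b lies in the ideal of [T], so the generators coming from
   [b] add nothing to the colon ideal. *)
- rewrite -setUA Tu TY; apply/esym/orb_idr => /andP[_ /hasP[b bs]].
  have bu : b != u by apply: contraNneq us => <-.
  have ba : b != a by apply: contraNneq a_s => <-.
  rewrite !inE (negbTE bu) (negbTE ba) andbF /= => bXW.
  rewrite -TX; apply: (sT a b); rewrite ?inE ?eqxx ?bs ?orbT // 1?eq_sym //.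
  by case/orP: bXW => ->; rewrite ?orbT.
- by rewrite TY => ->.
exists F; split=> //; apply: eq_resolves resF => f; apply: eq_sqfree => W.
have -> : (u |: [set a] :\: X \subset W) = (u \in W) && (a \in X :|: W).
  rewrite subUset sub1set; congr (_ && _).
  by rewrite subDset sub1set.
by rewrite -orbA -andb_orr [in X in _ || _ && X]orbC.
Qed.

(** The colon ideals are those of [ranks_edges], but multiplication by x_a need not lift without
    constant terms, so only a bound results. *)
Lemma rank_bound_vars T s p (q : V -> nat -> nat) :
  uniq s ->
  (forall a b W, a \in s -> b \in s -> a != b -> a \in W -> b \in W -> T W) ->
  rank_bound K T p -> (forall a, a \in s -> rank_bound K (fun W => T (a |: W)) (q a)) ->
  rank_bound K (fun W => T W || has (mem W) s) (shift_adds q p s).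
Proof.
move=> + + Tp; elim: s => [|a s IHs] /= uniq_s sT Tq.
  by apply: eq_rank_bound Tp => // W; rewrite orbF.
case/andP: uniq_s => a_s uniq_s.
have {}IHs : rank_bound K (fun W => T W || has (mem W) s) (shift_adds q p s).
  apply: IHs => // [b c W bs cs|b bs]; last by apply: Tq; rewrite inE bs orbT.
  by apply: sT; rewrite inE ?bs ?cs orbT.
have := rank_bound_cone (c := a) IHs (Tq a (mem_head _ _)).
case=> [W|F resF pF].
  apply/esym/orb_idr => /hasP[b bs bW].
  have ab : a != b by apply: contraNneq a_s => ->.
  apply: (sT a b); rewrite ?setU11 ?mem_head //.
  by rewrite inE bs orbT.
exists F => //; apply: eq_resolves resF => f; apply: eq_sqfree => W.
by rewrite -orbA [in X in _ || X]orbC.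
Qed.

(** A variable not involved in the ideal is a nonzerodivisor modulo it, so each cone glues two
    copies of the same resolution. *)
Lemma ranks_vars T s p :
  uniq s -> (forall a W, a \in s -> T (a |: W) = T W) -> ranks K T p ->
  ranks K (fun W => T W || has (mem W) s) (doubling (size s) p).
Proof.
move=> + + Tp; elim: s => [|a s IHs] /= uniq_s Ts.
  by apply: eq_ranks Tp => // W; rewrite orbF.
case/andP: uniq_s => a_s uniq_s.
have {}IHs : ranks K (fun W => T W || has (mem W) s) (doubling (size s) p).
  by apply: IHs => // b W bs; apply: Ts; rewrite inE bs orbT.
have := ranks_cone (u := a) (Y := set0) IHs IHs.
case=> [|W|W|F [resF minF pF]]; rewrite ?inE // ?set0U //.
  rewrite setU0 Ts ?mem_head //; congr (_ || _); apply: eq_in_has => b bs /=.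
  by rewrite !inE; case: eqP => // ba; rewrite -ba bs in a_s.
exists F; split=> //; apply: eq_resolves resF => f; apply: eq_sqfree => W.
by rewrite setU0 sub1set -orbA [in X in _ || X]orbC.
Qed.

End Colons.

(** * Induction along simplicial vertices *)

Section ChordalGraphs.

Variables (K : fieldType) (V : finType) (e : rel V).
Hypotheses (e_sym : ssrbool.symmetric e) (e_irr : irreflexive e).
Implicit Types (U X Y W A : {set V}) (u a : V).

Definition spans_edge X : bool := [exists x in X, exists y in X, e x y].

Lemma spans_edgeP X :
  reflect (exists x y, [/\ x \in X, y \in X & e x y]) (spans_edge X).
Proof.
apply: (iffP exists_inP) => [[x xX /exists_inP[y yX xy]]|[x [y [xX yX xy]]]].
  by exists x, y.
by exists x => //; apply/exists_inP; exists y.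
Qed.

Lemma spans_edgeS X Y : X \subset Y -> spans_edge X -> spans_edge Y.
Proof.
move=> /subsetP sXY /spans_edgeP[x [y [xX yX xy]]].
by apply/spans_edgeP; exists x, y; rewrite !sXY.
Qed.

(* The monomials of the colon ideal I(G[U]) : x_X. *)
Definition colon_edges U X W : bool := spans_edge (U :&: (X :|: W)).

(** The induction hypothesis covers all colon ideals by independent sets, and the comparison along
    inclusions supplies the inequalities that [face_shift_adds] requires. *)
Definition betti_system U (P : {set V} -> nat -> nat) : Prop :=
  (forall X, X \subset U -> ~~ spans_edge X ->
     ranks K (colon_edges U X) (P X) /\ face_vector (P X)) /\
  (forall X Y i, X \subset Y -> Y \subset U -> ~~ spans_edge Y -> P Y i <= P X i).

Lemma colon_edges_upward U X : upward (colon_edges U X).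
Proof. by move=> W W' sW; apply/spans_edgeS/setIS/setUS. Qed.

Lemma colon_edgesU U X Y W : colon_edges U X (Y :|: W) = colon_edges U (Y :|: X) W.
Proof. by rewrite /colon_edges setUCA setUA. Qed.

Lemma colon_edges_out U X a W : a \notin U -> colon_edges U X (a |: W) = colon_edges U X W.
Proof.
move=> aU; congr spans_edge; apply/setP=> v; rewrite !inE.
by case: eqP => // ->; rewrite (negbTE aU).
Qed.

Section RemoveSimplicial.

Variables (U : {set V}) (u : V).
Hypotheses (uU : u \in U) (u_simplicial : simplicial e U u).

Let U1 := U :\ u.
Let A := [set a in U1 | e u a].
Let U2 := U1 :\: A.
Let A_ X := [set a in A | ~~ spans_edge (a |: X)].

Lemma nbrP y : (y \in A) = (y \in U) && e u y.
Proof. by rewrite !inE; case: (eqVneq y u) => [->|//]; rewrite e_irr !andbF. Qed.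

Lemma edge_split W :
  spans_edge (U :&: W) = spans_edge (U1 :&: W) || (u \in W) && [exists a in A, a \in W].
Proof.
apply/spans_edgeP/orP=> [[x [y []]]|].
  rewrite !in_setI => /andP[xU xW] /andP[yU yW] xy.
  case: (eqVneq x u) => [xu|xu].
    by right; rewrite -xu xW; apply/exists_inP; exists y; rewrite // nbrP yU -xu.
  case: (eqVneq y u) => [yu|yu].
    by right; rewrite -yu yW; apply/exists_inP; exists x; rewrite // nbrP xU -yu e_sym.
  by left; apply/spans_edgeP; exists x, y; rewrite !inE xu xU xW yu yU yW.
case=> [edge1|/andP[uW /exists_inP[a]]].
  by apply/spans_edgeP; apply: spans_edgeS edge1; apply/setSI/subsetDl.
by rewrite nbrP => /andP[aU ua] aW; exists u, a; rewrite !inE uU uW aU aW.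
Qed.

Lemma nbr_clique a b : a \in A -> b \in A -> a != b -> e a b.
Proof. rewrite !nbrP => /andP[aU ua] /andP[bU ub]; exact: u_simplicial. Qed.

Lemma colon_clique X a b W :
  a \in A -> b \in A -> a != b -> a \in W -> b \in W -> colon_edges U1 X W.
Proof.
move=> aA bA ab aW bW; have eab := nbr_clique aA bA ab.
apply/spans_edgeP; exists a, b; move: aA bA; rewrite !in_set => /andP[-> _] /andP[-> _].
by rewrite aW bW !orbT.
Qed.

Lemma sub_U1 X : X \subset U -> u \notin X -> X \subset U1.
Proof. by move=> sXU uX; rewrite subsetD1 sXU. Qed.

(* A vertex of A outside A_ X is a variable of the colon ideal already. *)
Lemma independent_nbr X W a :
  X \subset U1 -> ~~ colon_edges U1 X W -> a \in A -> a \in X :|: W -> a \in A_ X.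
Proof.
move=> sX nT aA aXW; rewrite inE aA; apply: contra nT; apply: spans_edgeS.
rewrite subsetI !subUset !sub1set sX aXW subsetUl !andbT.
by move: aA; rewrite inE => /andP[].
Qed.

Lemma colon_edges_notin X W : X \subset U -> u \notin X ->
  colon_edges U X W = colon_edges U1 X W || (u \in W) && has (mem (X :|: W)) (enum (A_ X)).
Proof.
move=> sX uX; rewrite {1}/colon_edges edge_split -/(colon_edges U1 X W) in_setU (negbTE uX) orFb.
case: (boolP (colon_edges U1 X W)) => // nT; congr (_ || _ && _).
apply/exists_inP/hasP=> [[a aA aXW]|[a]]; last first.
  by rewrite mem_enum => /setIdP[aA _] aXW; exists a.
by exists a; rewrite // mem_enum (independent_nbr (sub_U1 sX uX) nT).
Qed.

(** Dividing by x_u turns every neighbour of [u] into a variable of the colon ideal. *)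
Lemma colon_edges_in X W : X \subset U -> u \notin X -> ~~ spans_edge (u |: X) ->
  colon_edges U (u |: X) W = colon_edges U1 X W || has (mem W) (enum A).
Proof.
move=> sX uX indX; rewrite {1}/colon_edges edge_split -setUA setU11 setUA -/(colon_edges _ _ _).
have -> : colon_edges U1 (u |: X) W = colon_edges U1 X W.
  by rewrite -colon_edgesU colon_edges_out // !inE eqxx.
congr (_ || _); apply/exists_inP/hasP=> [[a aA]|[a]]; last first.
  by rewrite mem_enum => aA aW; exists a; rewrite // !in_setU; apply/orP; right.
have aX : a \notin u |: X.
  apply: contra indX => aX; apply/spans_edgeP; exists u, a.
  by move: aA; rewrite nbrP setU11 aX => /andP[].
by rewrite in_setU (negbTE aX) /= => aW; exists a; rewrite ?mem_enum.
Qed.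

(** Modulo the variables in [A], edges meeting [A] are redundant, so the graph may be restricted to
    [U2]. *)
Lemma colon_edges_delete X W : X \subset U2 ->
  colon_edges U1 X W || has (mem W) (enum A) = colon_edges U2 X W || has (mem W) (enum A).
Proof.
move=> /subsetP sX; case: (boolP (has _ _)) => [|/hasPn nA]; rewrite ?orbT // !orbF.
congr spans_edge; apply/setP=> v; rewrite !in_setI [v \in U2]in_setD.
case: (boolP (v \in A)) => [vA|_]; last by [].
apply/negbTE/negP=> /andP[_]; rewrite in_setU => /orP[/sX|].
  by rewrite in_setD vA.
by apply/negP/nA; rewrite mem_enum.
Qed.

(** For [u] in [X] the ideal is that of [U2] plus free variables; otherwise the edges at [u] are
    adjoined to the ideal of [U1]. *)
Lemma betti_system_add P1 P2 :
  betti_system U1 P1 -> betti_system U2 P2 -> exists P, betti_system U P.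
Proof.
move=> [ranks1 mono1] [ranks2 mono2].
pose P X := if u \in X then doubling (size (enum A)) (P2 (X :\ u))
            else shift_adds (fun a => P1 (a |: X)) (P1 X) (enum (A_ X)).
have indS X Y : X \subset Y -> ~~ spans_edge Y -> ~~ spans_edge X.
  by move=> sXY; apply/contra/spans_edgeS.
have sA a X : X \subset U1 -> a \in A_ X -> a |: X \subset U1.
  by move=> sX; rewrite subUset sub1set sX andbT !inE => /andP[/andP[]].
have indA a X : a \in A_ X -> ~~ spans_edge (a |: X) by rewrite inE => /andP[].
have uA : u \notin A by rewrite nbrP e_irr andbF.
have sU2 X : X \subset U -> u \in X -> ~~ spans_edge X -> X :\ u \subset U2.
  move=> /subsetP sX uX indX; apply/subsetP=> v; rewrite !in_setD1 => /andP[vu vX].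
  rewrite [v \in U2]in_setD in_setD1 vu sX // nbrP sX // !andbT.
  apply: contra indX => uv.
  by apply/spans_edgeP; exists u, v.
have q1 X a : X \subset U1 -> a \in enum (A_ X) ->
    ranks K (fun W => colon_edges U1 X (a |: W)) (P1 (a |: X)).
  rewrite mem_enum => sX aA; have [R _] := ranks1 _ (sA _ _ sX aA) (indA _ _ aA).
  by apply: eq_ranks R => // W; rewrite colon_edgesU.
have clique_enum X a b W : a \in enum (A_ X) -> b \in enum (A_ X) -> a != b ->
    a \in W -> b \in W -> colon_edges U1 X W.
  by rewrite !mem_enum => /setIdP[aA _] /setIdP[bA _]; apply: colon_clique.
have ranksP X : X \subset U -> ~~ spans_edge X -> ranks K (colon_edges U X) (P X).
  move=> sX indX; rewrite /P; case: ifPn => uX.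
    have sX2 := sU2 _ sX uX indX.
    have [R _] := ranks2 _ sX2 (indS _ _ (subsetDl _ _) indX).
    have uX' : u \notin X :\ u by rewrite !inE eqxx.
    have sX' : X :\ u \subset U := subset_trans (subsetDl _ _) sX.
    have {R} := @ranks_vars K V (colon_edges U2 (X :\ u)) (enum A) _ (enum_uniq _) _ R.
    case=> [a W|F [resF minF pF]].
      by rewrite mem_enum => aA; apply: colon_edges_out; rewrite in_setD aA.
    exists F; split=> //; apply: eq_resolves resF => f; apply: eq_sqfree => W.
    by rewrite -colon_edges_delete // -colon_edges_in ?setD1K.
  have sX1 := sub_U1 sX uX; have [R _] := ranks1 _ sX1 indX.
  have uE : u \notin enum (A_ X) by rewrite mem_enum inE (negbTE uA).
  have uU1 : u \notin U1 by rewrite !inE eqxx.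
  have {R} := @ranks_edges K V (colon_edges U1 X) X u (enum (A_ X)) _ (fun a => P1 (a |: X))
    (@colon_edges_upward _ _) _ _ uE (enum_uniq _) (clique_enum X) R (fun a => q1 X a sX1) uX.
  case=> [W|W|F [resF minF pF]].
  - by rewrite colon_edgesU setUid.
  - exact: colon_edges_out.
  exists F; split=> //; apply: eq_resolves resF => f; apply: eq_sqfree => W.
  by rewrite colon_edges_notin.
have faceP X : X \subset U -> ~~ spans_edge X -> face_vector (P X).
  move=> sX indX; rewrite /P; case: ifPn => uX.
    apply: face_doubling; apply: (proj2 (ranks2 _ _ _)); first exact: sU2.
    exact: indS (subsetDl _ _) indX.
  have sX1 := sub_U1 sX uX; apply: face_shift_adds; first exact: (proj2 (ranks1 _ _ _)).
    by move=> a; rewrite mem_enum => aA; apply: (proj2 (ranks1 _ _ _)); [apply: sA | apply: indA].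
  by move=> a i; rewrite mem_enum => aA; apply: mono1; [apply: subsetUr | apply: sA | apply: indA].
have monoP X Y i : X \subset Y -> Y \subset U -> ~~ spans_edge Y ->
    (u \in X) = (u \in Y) -> P Y i <= P X i.
  move=> sXY sY indY uXY; rewrite /P uXY; case: ifPn => uY.
    apply: doubling_le => j; apply: mono2; first exact: setSD.
      exact: sU2.
    exact: indS (subsetDl _ _) indY.
  have sY1 := sub_U1 sY uY; rewrite !shift_addsE leq_add ?mono1 //.
  case: i => // i; rewrite !big_enum [leqLHS]big_mkcond [leqRHS]big_mkcond.
  apply: leq_sum => a _; case: (boolP (a \in A_ Y)) => // aAY.
  have -> : a \in A_ X.
    by move: aAY; rewrite !inE => /andP[-> indaY]; apply: indS indaY; apply: setUS.
  by apply: mono1; [apply: setUS | apply: sA | apply: indA].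
exists P; split=> [X sX indX|X Y i sXY sY indY]; first by split; [apply: ranksP | apply: faceP].
case: (boolP (u \in X)) => uX; first by apply: monoP => //; rewrite uX (subsetP sXY).
case: (boolP (u \in Y)) => uY; last by apply: monoP => //; rewrite (negbTE uX) (negbTE uY).
(* When only [Y] contains [u], the comparison passes through [Z]: from [X] to [Z] it is termwise,
   and from [Z] to [Y] it uses a cone. *)
set Z := Y :\ u; have sZY : Z \subset Y := subsetDl _ _.
have sZ : Z \subset U := subset_trans sZY sY; have indZ := indS _ _ sZY indY.
have uZ : u \notin Z by rewrite !inE eqxx.
apply: (@leq_trans (P Z i)); last first.
  by apply: monoP; rewrite ?(negbTE uX) ?(negbTE uZ) //; rewrite subsetD1 sXY.
have YE : Y = u |: Z by rewrite setD1K.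
apply: ranks_le_bound (ranksP Y sY indY) _.
have sZ1 := sub_U1 sZ uZ; have [R _] := ranks1 _ sZ1 indZ.
(* Adjoining the variables of [A_ Z] to the colon ideal of [Z] in [U1] resolves the ideal for [Y],
   possibly not minimally, with exactly the ranks [P Z]. *)
have {R} := @rank_bound_vars K V (colon_edges U1 Z) (enum (A_ Z)) _ (fun a => P1 (a |: Z))
  (enum_uniq _) (clique_enum Z) (ranks_bound R) (fun a aA => ranks_bound (q1 Z a sZ1 aA)).
apply: eq_rank_bound => [W|j]; last by rewrite /P (negbTE uZ).
rewrite YE colon_edges_in // -?YE //.
case: (boolP (colon_edges U1 Z W)) => //= nT.
apply/hasP/hasP=> -[a]; rewrite !mem_enum => aA aW; exists a; rewrite ?mem_enum //.
  by case/setIdP: aA.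
by apply: independent_nbr sZ1 nT aA _; rewrite in_setU; apply/orP; right.
Qed.

End RemoveSimplicial.

End ChordalGraphs.

(** * The edge ideal and its Betti numbers *)

Section EdgeIdeal.

Local Open Scope ring_scope.

Variables (K : fieldType) (V : finType) (e : rel V).
Local Notation S := {mpoly K[#|V|]}.

Lemma exists_betti_system (U : {set V}) :
  ssrbool.symmetric e -> irreflexive e -> chordal e -> exists P, betti_system K e U P.
Proof.
move=> e_sym e_irr e_chordal.
have [m] := ubnP #|U|; elim: m U => // m IHm U ltm.
have [->|Un0] := eqVneq U set0.
  exists (fun _ i => (i == 0)%N); split=> // X _ _; split; last exact: face_vector1.
  apply: eq_ranks (ranks_pred0 K V) => // W; apply/esym/negbTE/negP=> /spans_edgeP-[x [y []]].
  by rewrite set0I inE.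
have [u uU u_simp] := exists_simplicial e_sym e_irr e_chordal Un0.
have ltU1 : (#|U :\ u| < m)%N by rewrite (cardsD1 u U) uU in ltm.
have ltU2 : (#|(U :\ u) :\: [set a in U :\ u | e u a]| < m)%N.
  by apply: leq_ltn_trans ltU1; apply/subset_leq_card/subsetDl.
have [P1 sys1] := IHm _ ltU1; have [P2 sys2] := IHm _ ltU2.
exact: (betti_system_add e_sym e_irr uU u_simp sys1 sys2).
Qed.

Lemma edge_idealD f g :
  edge_ideal e f -> edge_ideal e g -> edge_ideal e (f + g : S).
Proof.
move=> [c ->] [d ->]; exists (fun u v => c u v + d u v).
rewrite -big_split; apply: eq_bigr => u _; rewrite -big_split.
by apply: eq_bigr => v _; rewrite mulrDl.
Qed.

Lemma edge_ideal_edge u v (f : S) : e u v -> edge_ideal e (f * (vvar K u * vvar K v)).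
Proof.
move=> uv; exists (fun u' v' => if (u' == u) && (v' == v) then f else 0).
rewrite (bigD1 u) //= (bigD1 v) //= !eqxx /= !big1 ?addr0 // => [u' /negbTE nu|v' /andP[_ /negbTE nv]].
  by rewrite big1 // => v' _; rewrite nu mul0r.
by rewrite nv mul0r.
Qed.

Lemma vsupp_vvar (v : V) : vsupp U_(enum_rank v)%MM = [set v].
Proof.
by apply/setP=> w; rewrite !inE mnm1E (inj_eq enum_rank_inj) eqb0 negbK eq_sym.
Qed.

(** A monomial whose support contains both ends of an edge is divisible by the edge monomial, as the
    ends are distinct. *)
Lemma edge_ideal_sqfree (f : S) :
  irreflexive e -> sqfree (colon_edges e setT set0) f <-> edge_ideal e f.
Proof.
move=> e_irr; split=> [Tf|[c ->]].
  rewrite [f]mpolyE big_seq; elim/big_ind: _ => [||m /Tf].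
  - exists (fun _ _ => 0); rewrite big1 // => u _; rewrite big1 // => v _; exact: mul0r.
  - exact: edge_idealD.
  rewrite /colon_edges set0U setTI => /spans_edgeP-[u [v [um vm uv]]].
  have le : (U_(enum_rank u) + U_(enum_rank v) <= m)%MM.
    have uv' : enum_rank u != enum_rank v.
      by rewrite (inj_eq enum_rank_inj); apply: contraTneq uv => ->; rewrite e_irr.
    apply/mnm_lepP=> i; rewrite mnmDE !mnm1E.
    move: um vm; rewrite !inE -!lt0n.
    case: (eqVneq (enum_rank u) i) => [ui|_]; case: (eqVneq (enum_rank v) i) => [vi|_] //=.
    - by rewrite ui vi eqxx in uv'.
    - by rewrite ui.
    by rewrite vi.
  rewrite -(submK le) mpolyXD mpolyXD scalerAl; exact: edge_ideal_edge.
move=> m /msupp_sum_le/flattenP[s /mapP[u _ ->]].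
move=> /msupp_sum_le/flattenP[{}s /mapP[v]]; rewrite mem_filter => /andP[uv _] ->.
rewrite /vvar -mpolyXD (perm_mem (msuppMX _ _)) => /mapP[m' _ ->].
apply/spans_edgeP; exists u, v; rewrite set0U setTI !vsuppD !vsupp_vvar !inE !eqxx !orbT.
by split.
Qed.

(** By [minimal_homology] the chosen resolution may be compared with a minimal one. The index shifts
    because [p] counts ranks for S / I. *)
Lemma betti_ranks (T : pred {set V}) (I : S -> Prop) p :
  (forall f, sqfree T f <-> I f) -> ~~ T set0 -> ranks K T p ->
  forall i, betti I i = p i.+1.
Proof.
move=> IT T0 [F [resF minF pF]] i.
have {}resF : resolves I F by apply: eq_resolves resF.
have resG : resolves I (chosen_resolution I).
  apply/resolvesE; apply: epsilon_spec; exists F; exact/resolvesE.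
rewrite /betti -pF /= -(minimal_homology i resF resG minF).
case: i => // ; set G := chosen_resolution I in resG *.
(* In degree 0 all vectors count as cycles; this agrees with the kernel of the augmentation modulo
   the variables, which vanishes because [I] contains no element with nonzero constant term. *)
have -> : const_mx0 (edif G 0) = 0.
  apply/matrixP=> j k; rewrite ord1 [RHS]mxE mxE; apply/eqP; rewrite mcoeff_eq0.
  have /IT Ij : I (edif G 0 j 0).
    apply/(proj1 resG); exists (delta_mx 0 j).
    by rewrite -rowE; apply/matrixP=> a b; rewrite !ord1 !mxE eqxx mulr1n.
  apply: contra T0 => /Ij; congr (is_true (T _)).
  by apply/setP=> v; rewrite !inE mnm0E.
by rewrite mxrank_ker mxrank0 subn0.
Qed.

End EdgeIdeal.

Theorem theorem2p1 (K : fieldType) (V : finType) (e : rel V)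
    (e_graph : simple_graph e) (e_chordal : chordal e) :
  exists (W : finType) (D : {set {set W}}),
    simplicial_complex D /\
    forall i : nat, f_vector D i = betti (@edge_ideal K V e) i.
Proof.
have [e_sym e_irr] := e_graph.
have [P [/(_ set0) ranksP _]] := exists_betti_system K [set: V] e_sym e_irr e_chordal.
have no_edge : ~~ spans_edge e set0.
  by apply/negP=> /spans_edgeP-[x [y []]]; rewrite inE.
have [R [kkP [N PN]]] := ranksP (sub0set _) no_edge.
(* Degree 0 of the resolution of S / I is [S] itself, matching the empty face. *)
have P0 : P set0 0 = 1 by case: R => F [_ _ <-].
have [W [D [complexD cardD]]] := kk_complex kkP P0 PN.
exists W, D; split=> // i; rewrite /f_vector cardD; symmetry.
apply: betti_ranks R _ => [f|]; first exact: edge_ideal_sqfree.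
by rewrite /colon_edges setU0 setTI.
Qed.
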